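(* For every fixed integer $d\ge 1$, the problem $d$-Cut is solvable in polynomial time on bipartite graphs of diameter at most $3$.
   Context: Graphs are finite, simple and undirected. The distance $\mathrm{dist}(u,v)$ is the length of a shortest path from $u$ to $v$; a graph has diameter at most $k$ if $\mathrm{dist}(u,v)\le k$ for all vertices $u,v$ (in particular such a graph is connected). For a fixed integer $d\ge 1$, a graph $G$ has a $d$-cut if $V(G)$ can be partitioned into two non-empty sets $A$ and $B$ such that every vertex in $A$ is adjacent to at most $d$ vertices in $B$ and every vertex in $B$ is adjacent to at most $d$ vertices in $A$. The decision problem $d$-Cut (with $d$ fixed, not part of the input) takes a graph $G$ as input and asks whether $G$ has a $d$-cut. *)

(* Defs.v *)
From mathcomp Require Import all_boot.

Set Implicit Arguments.
Unset Strict Implicit.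
Unset Printing Implicit Defensive.

Record sgraph := SGraph {
  vertex :> finType;
  adj : rel vertex;
  adj_sym : symmetric adj;
  adj_irrefl : irreflexive adj
}.

(* The path has vertex sequence u :: p, hence length [size p]. *)
Definition is_path (G : sgraph) (u v : G) (p : seq G) : bool :=
  [&& path (@adj G) u p, last u p == v & uniq (u :: p)].

(* dist(u,v) = k.  A relation rather than a function: no k is related to two
   vertices in different components (their distance is infinite). *)
Definition is_dist (G : sgraph) (u v : G) (k : nat) : Prop :=
  (exists2 p : seq G, is_path u v p & size p = k) /\
  (forall p : seq G, is_path u v p -> k <= size p).

Definition diameter_le (G : sgraph) (k : nat) : Prop :=
  forall u v : G, exists2 m, is_dist u v m & m <= k.

Definition bipartite (G : sgraph) : Prop :=
  exists X : {set G}, forall u v : G, adj u v -> (u \in X) != (v \in X).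

Definition is_d_cut (d : nat) (G : sgraph) (A B : {set G}) : Prop :=
  [/\ A != set0 /\ B != set0,
      A :|: B = setT /\ A :&: B = set0,
      forall u, u \in A -> #|[set v in B | adj u v]| <= d &
      forall u, u \in B -> #|[set v in A | adj u v]| <= d].

Definition has_d_cut (d : nat) (G : sgraph) : Prop :=
  exists A B : {set G}, is_d_cut d A B.

(* Polynomial time is taken on a unit-cost random access machine, programmed
   with structured control flow.  Its registers and its memory cells hold
   natural numbers; x, y, z below are register numbers, fixed by the program,
   and memory is accessed only through addresses held in registers.  The only
   arithmetic is addition and truncated subtraction: there is no
   multiplication, so one step lengthens the largest number by at most one bit
   (beyond the constants of the program), and the machine and a Turing machine
   simulate each other with polynomial overhead. *)
Inductive cmd : Type :=
| Skip
| Const (x c : nat)           (* R[x] := c *)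
| Add (x y z : nat)           (* R[x] := R[y] + R[z] *)
| Monus (x y z : nat)         (* R[x] := R[y] - R[z] *)
| Read (x y : nat)            (* R[x] := M[R[y]] *)
| Write (x y : nat)           (* M[R[x]] := R[y] *)
| Seq (p q : cmd)
| If (x : nat) (p q : cmd)    (* p if R[x] <> 0, else q *)
| While (x : nat) (p : cmd).  (* repeat p as long as R[x] <> 0 *)

Record state := State { reg : nat -> nat; mem : nat -> nat }.

Definition update (f : nat -> nat) (a v : nat) : nat -> nat :=
  fun b => if b == a then v else f b.

Definition set_reg (s : state) (x v : nat) : state :=
  State (update (reg s) x v) (mem s).

Definition set_mem (s : state) (a v : nat) : state :=
  State (reg s) (update (mem s) a v).

(* A configuration is the stack of commands still to be executed together with
   the current state; the machine has halted when the stack is empty. *)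
Definition config : Type := (seq cmd * state)%type.

Definition step (k : config) : config :=
  let: (stack, s) := k in
  if stack is c :: r then
    match c with
    | Skip => (r, s)
    | Const x n => (r, set_reg s x n)
    | Add x y z => (r, set_reg s x (reg s y + reg s z))
    | Monus x y z => (r, set_reg s x (reg s y - reg s z))
    | Read x y => (r, set_reg s x (mem s (reg s y)))
    | Write x y => (r, set_mem s (reg s x) (reg s y))
    | Seq p q => (p :: q :: r, s)
    | If x p q => ((if reg s x != 0 then p else q) :: r, s)
    | While x p => (if reg s x != 0 then p :: c :: r else r, s)
    end
  else k.

(* The input word w occupies the memory cells 0, ..., size w - 1, and its
   length is in register 0; everything else is 0. *)
Definition init (w : seq bool) : state :=
  State (fun x => if x == 0 then size w else 0) (fun i => nth false w i).

Definition halts_in (p : cmd) (w : seq bool) (t : nat) (s : state) : Prop :=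
  iter t step ([:: p], init w) = ([::], s).

Definition accepting (s : state) : bool := reg s 0 != 0.

(* The adjacency matrix, row by row: a word of length #|G| ^ 2. *)
Definition encode (G : sgraph) : seq bool :=
  [seq adj x y | x <- enum (vertex G), y <- enum (vertex G)].

(* The decision problem L, restricted to the input graphs satisfying C, is
   solvable in polynomial time; nothing is required of the program on inputs
   that do not encode a graph satisfying C. *)
Definition polytime_solvable_on (C L : sgraph -> Prop) : Prop :=
  exists (p : cmd) (a k : nat), forall G : sgraph, C G ->
    exists (t : nat) (s : state),
      [/\ halts_in p (encode G) t s,
          t <= a * (size (encode G)).+1 ^ k &
          accepting s <-> L G].

(* Main.v *)
Require Import Defs.
From mathcomp Require Import all_boot zify.

(** The reason is that a d-cut can be described by a bounded number of vertices.
    In a bipartite graph of diameter at most 3 any two vertices of the same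
    class have a common neighbour.  Choose vertices u_1, u_2, ... of one class
    greedily, each having at most 2d neighbours adjacent to the earlier ones, and
    let Q contain the u_i and all vertices adjacent to two of them; each choice
    adds at most 2d of the latter.  When 2d+1 vertices have been chosen, a vertex
    v outside Q with at most 2d neighbours adjacent to the u_i has a common
    neighbour with each u_i, so that two of these coincide; being adjacent to two
    of the u_i, it lies in Q, and v is adjacent to Q.  Hence a set Q of bounded size is found such that
    every vertex is in Q, or is adjacent to Q, or has more than 2d neighbours
    that are adjacent to Q ([linked_cover]).

    Let (A, B) be a d-cut.  Guess Q, its partition, and for each member of Q its
    at most d neighbours on the other side.  This places all vertices of Q and
    all their neighbours.  A remaining vertex of A has more than 2d placed
    neighbours, at most d of them in B, hence more than d in A, while a vertex
    of B never has more than d neighbours in A.  So A consists of the placed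
    vertices of A and of the vertices with more than d neighbours among those
    ([d_cut_grown]).  A d-cut therefore exists if and only if, for some tuple of
    vertices of constant length, the set that the tuple describes in this way
    is one side of a d-cut.

    This condition is a formula of constant size over the graph, built from
    adjacency and equality of vertices by Boolean operations and by counting the
    vertices with a given property.  A compiler into machine programs turns each
    such formula into nested loops over the vertices, that is, into a program
    running in polynomial time ([definable_polytime]).  The theorem follows by
    writing the formula ([holds_Cut]). *)

Set Implicit Arguments.
Unset Strict Implicit.
Unset Printing Implicit Defensive.

(** * Describing a d-cut by boundedly many vertices *)

Definition nbrs (G : sgraph) (v : G) : {set G} := [set w | adj v w].
Definition neighbourhood (G : sgraph) (U : {set G}) : {set G} := \bigcup_(u in U) nbrs u.

Definition covers (G : sgraph) (t : nat) (Q : {set G}) (v : G) : bool :=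
  [|| v \in Q, v \in neighbourhood Q | t < #|nbrs v :&: neighbourhood Q|].

(** Satisfied by each class of a bipartite graph of diameter at most 3. *)
Definition linked (G : sgraph) (X : {set G}) : Prop :=
  {in X &, forall u v, u != v -> exists2 c, adj u c & adj v c}.

Lemma card_setU_le (T : finType) (A B : {set T}) : #|A :|: B| <= #|A| + #|B|.
Proof. exact: leq_card_setU. Qed.

Lemma in_neighbourhood (G : sgraph) (U : {set G}) v :
  reflect (exists2 u, u \in U & adj u v) (v \in neighbourhood U).
Proof.
by apply: (iffP bigcupP) => -[u uU]; rewrite ?inE => h; exists u; rewrite ?inE.
Qed.

(** The greedy choice is made by maximality.  A set [U] is admissible if few
    vertices, compared with [#|U|], have two neighbours in [U]; these vertices
    form [D U].  A vertex of [X] with at most [t] neighbours adjacent to [U]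
    raises [#|D U|] by at most [t], so it can be added to [U] unless [U] has
    [t.+1] elements already. *)
Lemma linked_cover (G : sgraph) (X : {set G}) t : linked X ->
  exists2 Q : {set G}, #|Q| <= t.+1 ^ 2 & {in X, forall v, covers t Q v}.
Proof.
move=> linkX.
pose D (U : {set G}) := [set c | 1 < #|nbrs c :&: U|].
pose ok (U : {set G}) := [&& U \subset X, #|U| <= t.+1 & #|D U| <= t * #|U|].
have ok0 : ok set0.
  rewrite /ok sub0set cards0 muln0 /= leqn0 cards_eq0; apply/eqP/setP=> c.
  by rewrite !inE setI0 cards0.
case: (arg_maxnP (fun U : {set G} => #|U|) ok0) => U /and3P[UX Ut DU] Umax.
exists (U :|: D U).
  apply: leq_trans (card_setU_le _ _) _.
  by rewrite -mulnn mulSn leq_add // (leq_trans DU) // leq_mul2l Ut orbT.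
move=> v vX; apply/negPn/negP; rewrite /covers !negb_or -leqNgt.
case/and3P=> vQ vNQ vt.
have vU : v \notin U by apply: contraNN vQ; rewrite inE => ->.
have NU : neighbourhood U \subset neighbourhood (U :|: D U).
  by apply/bigcupsP=> u uU; apply: bigcup_sup; rewrite inE uU.
have vtU : #|nbrs v :&: neighbourhood U| <= t.
  by apply: leq_trans vt; apply: subset_leq_card; apply: setIS.
have [Ult|] := ltnP #|U| t.+1.
  have cvU : #|v |: U| = #|U|.+1 by rewrite cardsU1 vU.
  (* a vertex new in D (v |: U) is adjacent to v and to exactly one vertex of U *)
  suff /Umax /= : ok (v |: U) by rewrite cvU; lia.
  rewrite /ok subUset sub1set vX UX cvU Ult mulnS /=.
  apply: leq_trans (leq_add vtU DU); rewrite addnC.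
  apply: leq_trans (card_setU_le _ _); apply: subset_leq_card.
  apply/subsetP=> c; rewrite !inE => c1.
  case: ltnP => //= c2; rewrite andbC.
  have cv : adj c v.
    apply/negPn/negP=> cv; move: c1; rewrite ltnNge; case/negP.
    apply: leq_trans c2; apply: subset_leq_card; apply/subsetP=> w.
    rewrite !inE => /andP[cw /orP[/eqP ew|wU]]; last by rewrite cw.
    by rewrite -ew cw in cv.
  rewrite adj_sym cv andbT; apply/in_neighbourhood.
  have : 0 < #|(nbrs c :&: (v |: U)) :\ v|.
    by rewrite (cardsD1 v) in c1; move: c1; case: (v \in _); lia.
  case/card_gt0P=> w; rewrite !inE => /and3P[/negPf -> cw /= wU].
  by exists w; rewrite // adj_sym.
move=> Ueq.
(* v has at most t neighbours adjacent to U, so two of the t.+1 vertices of U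
   have the same common neighbour with v, and this neighbour is in D U *)
pose f (u : G) := odflt v [pick c | adj u c && adj v c].
have fP u : u \in U -> adj u (f u) && adj v (f u).
  move=> uU; rewrite /f; case: pickP => //= nf.
  have [|||c uc vc] // := linkX u v; first exact: (subsetP UX).
    by apply/eqP=> e; rewrite -e uU in vU.
  by have := nf c; rewrite /= uc vc.
have : ~~ [forall u in U, forall w in U, (f u == f w) ==> (u == w)].
  apply/negP=> /forall_inP finj.
  have : #|f @: U| <= #|nbrs v :&: neighbourhood U|.
    apply: subset_leq_card; apply/subsetP=> _ /imsetP[u uU ->].
    have /andP[uc vc] := fP _ uU.
    by rewrite !inE vc; apply/in_neighbourhood; exists u.
  rewrite card_in_imset; first lia.
  move=> u w uU wU e; apply/eqP.
  by have /forall_inP/(_ w wU) := finj u uU; rewrite e eqxx.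
case/forall_inPn => u uU /forall_inPn[w wU]; rewrite negb_imply => /andP[/eqP fe uw].
have /andP[uc vc] := fP _ uU; have /andP[wc _] := fP _ wU.
case/negP: vNQ; apply/in_neighbourhood; exists (f u); last by rewrite adj_sym.
rewrite inE; apply/orP; right; rewrite inE.
apply: (@leq_trans #|[set u; w]|); first by rewrite cards2 uw.
apply: subset_leq_card; apply/subsetP=> z; rewrite !inE.
by case/orP=> /eqP ->; rewrite adj_sym ?uc ?uU //= fe wc.
Qed.

(** Vertices of the same class have an even distance, hence distance 0 or 2. *)
Lemma bipartite_diameter3_linked (G : sgraph) (X : {set G}) :
  (forall u v : G, adj u v -> (u \in X) != (v \in X)) -> diameter_le G 3 ->
  linked X.
Proof.
move=> bip diam u v uX vX uv; have [m [[p /and3P[pth lst _] <-] _]] := diam u v.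
case: p pth lst => [|a [|b [|c [|? ?]]]] //=.
- by move=> _ /eqP e; rewrite e eqxx in uv.
- by move=> /andP[/bip h _] /eqP e; move: h; rewrite e uX vX.
- move=> /and3P[ua ab _] /eqP e _; exists a => //; by rewrite adj_sym -e.
move=> /and4P[/bip h1 /bip h2 /bip h3 _] /eqP e _; exfalso; move: h1 h2 h3.
by rewrite e uX vX; case: (a \in X); case: (b \in X).
Qed.

(** [P] are known vertices of one side [A] of a cut, [E] are vertices of the
    other side that include the neighbours of [P] there, and [F] are further
    vertices of [A]: a neighbour of [P] outside [E] is known to be in [A]. *)
Definition seeds (G : sgraph) (P E F : seq G) : {set G} :=
  [set v | (v \in F) || (v \notin E) && has (@adj G ^~ v) P].

Definition grow (G : sgraph) (d : nat) (S : {set G}) : {set G} :=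
  [set v | (v \in S) || (d < #|nbrs v :&: S|)].

Lemma pad_set (T : finType) (A : {set T}) x L : #|A| <= L ->
  exists2 s : seq T, size s = L & {subset s <= x |: A} /\ {subset A <= s}.
Proof.
move=> AL; exists (enum A ++ nseq (L - #|A|) x).
  by rewrite size_cat size_nseq -cardE subnKC.
split=> y; rewrite mem_cat mem_enum; last by move=> ->.
by rewrite !inE => /orP[->|/nseqP[-> _]]; rewrite ?eqxx ?orbT.
Qed.

(** The cover consists of at most [(2 * d).+1 ^ 2] vertices for each class of the
    bipartition, and of one vertex that ensures that it meets [A]. *)
Definition cover_bound d := (2 * (2 * d).+1 ^ 2).+1.
(** The longest list holds the vertices of the cover in [A] and the neighbours in
    [A], at most [d] for each, of the vertices of the cover outside [A]. *)
Definition num_seeds d := d.+1 * cover_bound d.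

Lemma card_bigcup_le (T U : finType) (A : {set T}) (F : T -> {set U}) d :
  {in A, forall x, #|F x| <= d} -> #|\bigcup_(x in A) F x| <= d * #|A|.
Proof.
move=> h; rewrite mulnC -sum_nat_const.
apply: (@leq_trans (\sum_(x in A) #|F x|)); last exact: leq_sum.
elim/big_rec2: _ => [|x m S _ le]; first by rewrite cards0.
by apply: leq_trans (card_setU_le _ _) _; rewrite leq_add2l.
Qed.

(** The three lists are taken from a cover [Q] that contains the vertex [a] of
    [A]: [P] is [Q :&: A], [E] the neighbours of [P] in [B], and [F] is
    [Q :&: A] with the neighbours in [A] of [Q :&: B].  They are padded to a
    common length by [a], [b] and [a]; the seeds then are the vertices of [A] in
    [Q] or adjacent to [Q], whatever the padding. *)
Lemma d_cut_grown (G : sgraph) d (A B : {set G}) :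
  bipartite G -> diameter_le G 3 -> is_d_cut d A B ->
  exists P E F : seq G,
    [/\ size P = num_seeds d, size E = num_seeds d, size F = num_seeds d &
        A = grow d (seeds P E F)].
Proof.
move=> [X bip] diam [[/set0Pn[a aA] /set0Pn[b bB]] [AB AB0] cutA cutB].
have inB v : (v \in B) = (v \notin A).
  move/setP/(_ v): AB; move/setP/(_ v): AB0; rewrite !inE.
  by case: (v \in A); case: (v \in B).
have [Q1 Q1le Q1X] := linked_cover (2 * d) (bipartite_diameter3_linked bip diam).
have bipC u v : adj u v -> (u \in ~: X) != (v \in ~: X).
  by move=> /bip; rewrite !inE; case: (u \in X); case: (v \in X).
have [Q2 Q2le Q2X] := linked_cover (2 * d) (bipartite_diameter3_linked bipC diam).
pose Q := a |: (Q1 :|: Q2).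
have Qle : #|Q| <= cover_bound d.
  rewrite /Q /cover_bound cardsU1 mul2n -addnn -add1n leq_add ?leq_b1 //.
  by rewrite (leq_trans (card_setU_le _ _)) ?leq_add.
have coverS (Q' : {set G}) v : Q' \subset Q -> covers (2 * d) Q' v -> covers (2 * d) Q v.
  move=> sQ; have sN : neighbourhood Q' \subset neighbourhood Q.
    by apply/bigcupsP=> u uU; apply: bigcup_sup; apply: (subsetP sQ).
  case/or3P=> h; apply/or3P; [constructor 1 | constructor 2 | constructor 3].
  - exact: (subsetP sQ).
  - exact: (subsetP sN).
  by apply: leq_trans h _; apply: subset_leq_card; apply: setIS.
have cov v : covers (2 * d) Q v.
  case: (boolP (v \in X)) => vX.
    by apply: coverS (Q1X v vX); apply/subsetP=> w; rewrite !inE => ->; rewrite orbT.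
  apply: coverS (Q2X v _); rewrite ?inE //.
  by apply/subsetP=> w; rewrite !inE => ->; rewrite !orbT.
pose across (C D : {set G}) := \bigcup_(q in Q :&: C) (nbrs q :&: D).
have across_le (C D : {set G}) :
    (forall u, u \in C -> #|[set v in D | adj u v]| <= d) ->
    #|across C D| <= d * cover_bound d.
  move=> h; apply: (@leq_trans (d * #|Q :&: C|)).
    apply: card_bigcup_le => q /setIP[_ qC]; apply: leq_trans (h q qC).
    by apply: subset_leq_card; apply/subsetP=> w; rewrite !inE andbC.
  rewrite leq_mul2l; apply/orP; right; apply: leq_trans Qle.
  exact: subset_leq_card (subsetIl _ _).
have QAle : #|Q :&: A| <= cover_bound d.
  by apply: leq_trans Qle; exact: subset_leq_card (subsetIl _ _).
have wA := across_le A B cutA; have wB := across_le B A cutB.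
have Ple : #|Q :&: A| <= num_seeds d by rewrite /num_seeds mulSn; lia.
have Ele : #|across A B| <= num_seeds d by rewrite /num_seeds mulSn; lia.
have Fle : #|(Q :&: A) :|: across B A| <= num_seeds d.
  by have := card_setU_le (Q :&: A) (across B A); rewrite /num_seeds mulSn; lia.
have [P sP [P1 P2]] := pad_set a Ple.
have [E sE [E1 E2]] := pad_set b Ele.
have [F sF [F1 F2]] := pad_set a Fle.
exists P, E, F; split=> //.
have PA p : p \in P -> p \in Q :&: A.
  by move/P1; rewrite !inE => /orP[/eqP ->|//]; rewrite eqxx.
have EB e : e \in E -> e \in B.
  move/E1; rewrite !inE => /orP[/eqP -> //|].
  by case/bigcupP=> q _ /setIP[].
have FA f : f \in F -> f \in A.
  move/F1; rewrite !inE => /or3P[/eqP -> //|/andP[] //|].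
  by case/bigcupP=> q _ /setIP[].
have seedsE v : (v \in seeds P E F) = (v \in A) && ((v \in Q) || (v \in neighbourhood Q)).
  apply/idP/idP.
    rewrite inE => /orP[vF|/andP[vE /hasP[p pP pv]]].
      rewrite (FA _ vF) /=; move/F1: vF; rewrite !inE.
      case/or3P=> [->//|/andP[-> //]|/bigcupP[q]].
      rewrite !inE => /andP[qQ _] /andP[qv _]; apply/orP; right.
      by apply/in_neighbourhood; exists q; rewrite // !inE.
    have /setIP[pQ pA] := PA _ pP.
    apply/andP; split; last by apply/orP; right; apply/in_neighbourhood; exists p.
    apply: contraNT vE => vA; apply: E2; apply/bigcupP; exists p; rewrite !inE //.
      by move: pQ; rewrite !inE => ->.
    by rewrite pv inB.
  case/andP=> vA /orP[vQ|/in_neighbourhood[q qQ qv]]; rewrite inE.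
    by rewrite F2 // inE [v \in _ :&: _]inE vQ vA.
  case: (boolP (q \in A)) => qA.
    apply/orP; right; apply/andP; split; last first.
      by apply/hasP; exists q => //; apply: P2; rewrite inE qQ.
    by apply/negP=> /EB; rewrite inB vA.
  apply/orP; left; apply: F2; rewrite inE; apply/orP; right.
  by apply/bigcupP; exists q; rewrite inE ?qQ ?inB // inE qv.
have seedsA : seeds P E F \subset A by apply/subsetP=> v; rewrite seedsE => /andP[].
(* a vertex outside A has too few neighbours in A to be added by grow *)
apply/setP=> v; apply/idP/idP; last first.
  rewrite inE => /orP[/(subsetP seedsA) //|dv].
  apply: contraLR dv => vA; rewrite -leqNgt; rewrite -inB in vA.
  apply: leq_trans (cutB v vA); apply: subset_leq_card; apply/subsetP=> w.
  case/setIP=> vw /(subsetP seedsA) wiA.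
  by move: vw; rewrite !inE wiA.
move=> vA; rewrite inE.
have [vK|] := boolP ((v \in Q) || (v \in neighbourhood Q)); first by rewrite seedsE vA vK.
rewrite negb_or => /andP[vQ vN].
have /or3P[h|h|dd] := cov v; [by rewrite h in vQ | by rewrite h in vN |].
(* more than 2d neighbours of v are adjacent to Q, at most d of them are in B *)
apply/orP; right; have le : #|(nbrs v :&: neighbourhood Q) :&: B| <= d.
  apply: leq_trans (cutA v vA); apply: subset_leq_card; apply/subsetP=> w.
  by rewrite !inE => /andP[/andP[-> _] ->].
have le2 : #|(nbrs v :&: neighbourhood Q) :\: B| <= #|nbrs v :&: seeds P E F|.
  apply: subset_leq_card; apply/subsetP=> w; rewrite inE [w \in _ :&: _]inE.
  by rewrite inB negbK => /and3P[wiA vw wN]; rewrite inE vw seedsE wiA wN orbT.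
by have := cardsID B (nbrs v :&: neighbourhood Q); lia.
Qed.

(** * Reasoning about machine programs *)

(** [mem] is also the name of a function on predicates. *)
Local Notation memory := Defs.mem.

(** Total correctness with a time bound, for execution from the state [s].  The
    quantification over the rest of the stack makes executions compose. *)
Definition run (c : cmd) (T : nat) (s : state) (Q : state -> Prop) : Prop :=
  exists t s', [/\ forall r, iter t step (c :: r, s) = (r, s'), t <= T & Q s'].

Lemma run_weaken c T T' s (Q Q' : state -> Prop) :
  T <= T' -> (forall s', Q s' -> Q' s') -> run c T s Q -> run c T' s Q'.
Proof.
move=> TT' QQ' [t [s' [h1 h2 h3]]]; exists t, s'.
by split=> //; [apply: leq_trans h2 _ | apply: QQ'].
Qed.

Lemma run_Const x n s (Q : state -> Prop) :
  Q (set_reg s x n) -> run (Const x n) 1 s Q.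
Proof. by move=> q; exists 1, (set_reg s x n). Qed.

Lemma run_Add (x y z : nat) s (Q : state -> Prop) :
  Q (set_reg s x (reg s y + reg s z)) -> run (Add x y z) 1 s Q.
Proof. by move=> q; exists 1; eexists. Qed.

Lemma run_Monus (x y z : nat) s (Q : state -> Prop) :
  Q (set_reg s x (reg s y - reg s z)) -> run (Monus x y z) 1 s Q.
Proof. by move=> q; exists 1; eexists. Qed.

Lemma run_Read (x y : nat) s (Q : state -> Prop) :
  Q (set_reg s x (memory s (reg s y))) -> run (Read x y) 1 s Q.
Proof. by move=> q; exists 1; eexists. Qed.

Lemma run_Seq (Q1 : state -> Prop) T1 T2 p q T s (Q : state -> Prop) :
  run p T1 s Q1 -> (forall s1, Q1 s1 -> run q T2 s1 Q) ->
  (T1 + T2).+1 <= T -> run (Seq p q) T s Q.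
Proof.
move=> [t1 [s1 [e1 l1 q1]]] h lT; have [t2 [s2 [e2 l2 q2]]] := h _ q1.
exists (t2 + t1).+1, s2; split=> //; last by lia.
by move=> r; rewrite iterSr /= iterD e1 e2.
Qed.

(** The form used when [p] is a basic command: the precondition of [q] is the
    weakest one, so that straight-line code is executed symbolically. *)
Lemma run_Seq1 p q T s (Q : state -> Prop) :
  run p 1 s (fun s1 => run q T s1 Q) -> run (Seq p q) T.+2 s Q.
Proof. by move=> h; apply: (run_Seq (T2 := T) h). Qed.

Lemma run_If x p q T s (Q : state -> Prop) :
  run (if reg s x != 0 then p else q) T s Q -> run (If x p q) T.+1 s Q.
Proof.
move=> [t [s' [e l h]]]; exists t.+1, s'; split=> // r.
by rewrite iterSr /= e.
Qed.

(** [I j] is the loop invariant after [j] of the [n] iterations. *)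
Lemma run_While (I : nat -> state -> Prop) n x p T s :
  (forall j s1, j < n -> I j s1 -> reg s1 x != 0 /\ run p T s1 (I j.+1)) ->
  (forall s1, I n s1 -> reg s1 x = 0) ->
  I 0 s -> run (While x p) (n * T.+1).+1 s (I n).
Proof.
move=> body done.
suff loop k : k <= n -> forall s1, I (n - k) s1 ->
    run (While x p) (k * T.+1).+1 s1 (I n).
  by move=> I0; apply: loop; rewrite ?subnn.
elim: k => [|k IHk] kn s1 Is1.
  rewrite subn0 in Is1; exists 1, s1; split=> // r /=.
  by rewrite (done _ Is1).
have jn : n - k.+1 < n by lia.
have [x0 [t [s2 [e l Is2]]]] := body _ s1 jn Is1.
rewrite (_ : (n - k.+1).+1 = n - k) in Is2; last lia.
have [t' [s3 [e' l' Is3]]] := IHk (ltnW kn) _ Is2.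
exists (t' + t).+1, s3; split=> //; last by rewrite mulSn; lia.
by move=> r; rewrite iterSr /= x0 iterD e e'.
Qed.

Lemma halts_in_run p w T (Q : state -> Prop) :
  run p T (init w) Q -> exists t s, [/\ halts_in p w t s, t <= T & Q s].
Proof. by move=> [t [s [e l q]]]; exists t, s; split=> //; apply: e. Qed.

(** * Compiling counting formulas *)

(** Variables are de Bruijn indices and range over the vertices, numbered from 0;
    [Sum] binds the variable 0 and adds up over all vertices.  Numbers also serve
    as truth values, nonzero meaning true, so that [Sum] is both the existential
    quantifier and, on values 0 and 1, counting. *)
Inductive expr : Type :=
| Cst (c : nat)
| Var (i : nat)
| Adj (i j : nat)
| Sub (a b : expr)
| Ite (a b c : expr)
| Sum (a : expr).

(** [m] lists the rows of the [n] x [n] adjacency matrix one after the other. *)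
Fixpoint eval (n : nat) (m : nat -> nat) (e : expr) (env : seq nat) : nat :=
  match e with
  | Cst c => c
  | Var i => nth 0 env i
  | Adj i j => m (nth 0 env i * n + nth 0 env j)
  | Sub a b => eval n m a env - eval n m b env
  | Ite a b c =>
      if eval n m a env != 0 then eval n m b env else eval n m c env
  | Sum a => \sum_(v < n) eval n m a (val v :: env)
  end.

(** The value of [e] is left in register [r], and the registers below [r] are
    kept.  Register 1 holds [n], register 2 holds 1, registers 3 and 4 hold 0.
    The variable [i] occupies two registers, [x := nth 3 rho i] and [x.+1], which
    hold its value [v] and the address [v * n] of its matrix row: as there is no
    multiplication, the loop of a [Sum] advances both.  The default 3 gives
    unbound variables the value 0, in agreement with [eval]. *)
Fixpoint compile (e : expr) (rho : seq nat) (r : nat) : cmd :=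
  match e with
  | Cst c => Const r c
  | Var i => Add r (nth 3 rho i) 3
  | Adj i j => Seq (Add r (nth 3 rho i).+1 (nth 3 rho j)) (Read r r)
  | Sub a b =>
      Seq (compile a rho r) (Seq (compile b rho r.+1) (Monus r r r.+1))
  | Ite a b c =>
      Seq (compile a rho r) (If r (compile b rho r) (compile c rho r))
  | Sum a =>
      Seq (Const r 0) (Seq (Const r.+1 0) (Seq (Const r.+2 0)
        (Seq (Add r.+3 1 3)
          (While r.+3
             (Seq (compile a (r.+1 :: rho) r.+4)
             (Seq (Add r r r.+4)
             (Seq (Add r.+1 r.+1 2)
             (Seq (Add r.+2 r.+2 1)
                  (Monus r.+3 r.+3 2)))))))))
  end.

(** The constants count the steps of the basic commands and one step for each
    [Seq], [If] and test of a [While]. *)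
Fixpoint cost (e : expr) (n : nat) : nat :=
  match e with
  | Cst _ | Var _ => 1
  | Adj _ _ => 3
  | Sub a b => cost a n + cost b n + 3
  | Ite a b c => cost a n + cost b n + cost c n + 2
  | Sum a => n * (cost a n + 9) + 9
  end.

Lemma cost_poly e : exists a k, forall n, cost e n <= a * n.+1 ^ k.
Proof.
have mono a k k' n : k <= k' -> a * n.+1 ^ k <= a * n.+1 ^ k'.
  by move=> kk'; rewrite leq_mul2l leq_pexp2l ?orbT.
elim: e => /=.
- by move=> _; exists 1, 0.
- by move=> _; exists 1, 0.
- by move=> _ _; exists 3, 0.
- move=> e1 [a1 [k1 h1]] e2 [a2 [k2 h2]]; exists (a1 + a2 + 3), (k1 + k2) => n.
  have := leq_trans (h1 n) (mono a1 _ _ n (leq_addr k2 k1)).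
  have := leq_trans (h2 n) (mono a2 _ _ n (leq_addl k1 k2)).
  have := expn_gt0 n.+1 (k1 + k2); move: (n.+1 ^ _) => X.
  by rewrite !mulnDl; lia.
- move=> e1 [a1 [k1 h1]] e2 [a2 [k2 h2]] e3 [a3 [k3 h3]].
  exists (a1 + a2 + a3 + 2), (k1 + k2 + k3) => n.
  have le1 : k1 <= k1 + k2 + k3 by lia.
  have le2 : k2 <= k1 + k2 + k3 by lia.
  have := leq_trans (h1 n) (mono a1 _ _ n le1).
  have := leq_trans (h2 n) (mono a2 _ _ n le2).
  have := leq_trans (h3 n) (mono a3 _ _ n (leq_addl (k1 + k2) k3)).
  have := expn_gt0 n.+1 (k1 + k2 + k3); move: (n.+1 ^ _) => X.
  by rewrite !mulnDl; lia.
move=> e [a [k h]]; exists (a + 9), k.+1 => n; rewrite expnS.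
have k0 : 0 < n.+1 ^ k by rewrite expn_gt0.
have := leq_pmulr n.+1 k0; move: (h n).
move: (n.+1 ^ k) => X hX; rewrite mulnDr.
have := leq_mul (leqnn n) hX; rewrite mulnDl mulnCA mulSn mulnDr mulnCA.
by lia.
Qed.

Definition represents (n : nat) (s : state) (rho env : seq nat) (r : nat) : Prop :=
  [/\ reg s 1 = n, reg s 2 = 1 &
      forall i, let x := nth 3 rho i in
        [/\ x.+1 < r, 2 < x, reg s x = nth 0 env i & reg s x.+1 = nth 0 env i * n]].

Lemma represents_frame n s s' rho env r r' :
  (forall x, x < r -> reg s' x = reg s x) -> 2 < r -> r <= r' ->
  represents n s rho env r -> represents n s' rho env r'.
Proof.
move=> fr r2 rr' [s1 s2 sx]; split; rewrite ?fr //; try lia.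
by move=> i x; have [h1 h2 h3 h4] := sx i; split; rewrite ?fr //; rewrite /x; lia.
Qed.

(** Every variable beyond [rho] and [env] is stored in register 3. *)
Lemma represents_zero n s rho env r : represents n s rho env r -> reg s 3 = 0.
Proof.
case=> _ _ /(_ (size rho + size env)) [_ _].
by rewrite !nth_default ?leq_addr ?leq_addl.
Qed.

Arguments update : simpl never.

Lemma compile_correct e n m rho env r s :
  memory s = m -> 2 < r -> represents n s rho env r ->
  run (compile e rho r) (cost e n) s (fun s' =>
    [/\ memory s' = m, reg s' r = eval n m e env &
        forall x, x < r -> reg s' x = reg s x]).
Proof.
have upd_same f a v : update f a v a = v by rewrite /update eqxx.
have upd_neq f a v b : b != a -> update f a v b = f b.
  by rewrite /update => /negPf ->.
elim: e rho env r s => [c|i|i j|e1 IH1 e2 IH2|e1 IH1 e2 IH2 e3 IH3|e IH]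
    rho env r s ms r2 rep /=.
- apply: run_Const; split=> //= x xr.
  by rewrite upd_neq //; lia.
- apply: run_Add; split=> //= [|x xr]; last by rewrite upd_neq //; lia.
  rewrite upd_same (represents_zero rep) addn0.
  by case: rep => _ _ /(_ i) [].
- apply: run_Seq1; apply: run_Add; apply: run_Read.
  split=> //= [|x xr]; last by rewrite !upd_neq //; lia.
  case: rep => _ _ rep; have [_ _ _ ->] := rep i; have [_ _ -> _] := rep j.
  by rewrite !upd_same ms.
- apply: (run_Seq (T2 := cost e2 n + 2) (IH1 _ _ _ _ ms r2 rep)); last by lia.
  move=> s1 [m1 v1 f1].
  have rep1 : represents n s1 rho env r.+1 by apply: represents_frame rep.
  apply: (run_Seq (T2 := 1) (IH2 _ _ _ _ m1 _ rep1)); [by lia| |by lia].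
  move=> s2 [m2 v2 f2]; apply: run_Monus; split=> //= [|x xr].
    by rewrite upd_same v2 f2 // v1.
  by rewrite upd_neq ?f2 ?f1 //; lia.
- apply: (run_Seq (T2 := (cost e2 n + cost e3 n).+1) (IH1 _ _ _ _ ms r2 rep));
    last by lia.
  move=> s1 [m1 v1 f1]; apply: run_If; rewrite v1.
  have rep1 : represents n s1 rho env r by apply: represents_frame rep.
  have fr s2 x : (forall y, y < r -> reg s2 y = reg s1 y) -> x < r ->
    reg s2 x = reg s x by move=> f2 xr; rewrite f2 ?f1.
  case: ifP => _.
    apply: (run_weaken _ _ (IH2 _ _ _ _ m1 r2 rep1)); first by lia.
    by move=> s2 [m2 v2 f2]; split=> // x; apply: fr.
  apply: (run_weaken _ _ (IH3 _ _ _ _ m1 r2 rep1)); first by lia.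
  by move=> s2 [m2 v2 f2]; split=> // x; apply: fr.
(* r: partial sum; r.+1, r.+2: the bound variable; r.+3: iterations left *)
pose I j (s1 : state) := [/\ memory s1 = m, represents n s1 rho env r,
  forall x, x < r -> reg s1 x = reg s x &
  [/\ reg s1 r = \sum_(v < j) eval n m e (val v :: env),
      reg s1 r.+1 = j, reg s1 r.+2 = j * n & reg s1 r.+3 = n - j]].
rewrite (_ : _ + 9 = (n * (cost e n + 8).+1).+1.+2.+2.+2.+2); last by lia.
have [rep1 rep2 _] := rep.
have reg3 := represents_zero rep.
do 3 (apply: run_Seq1; apply: run_Const); apply: run_Seq1; apply: run_Add.
apply: (@run_weaken _ _ _ _ (I n)) => [|s1 [] //|]; first exact: leqnn.
  by move=> m1 _ f1 [v1 _ _ _].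
apply: run_While => [j s1 jn|s1 [_ _ _ [_ _ _ ->]]|]; last 2 first.
- by rewrite subnn.
- set s0 := set_reg _ _ _.
  have fr x : x < r -> reg s0 x = reg s x.
    by move=> xr; rewrite /= !upd_neq //; lia.
  split=> //; first exact: represents_frame rep.
  rewrite big_ord0 subn0 /= /update.
  by split; repeat (case: eqP => ?); lia.
move=> [m1 rep1' f1 [acc vj rj cj]]; split; first by rewrite cj; lia.
have repe : represents n s1 (r.+1 :: rho) (j :: env) r.+4.
  have [h1 h2 hx] := rep1'; split=> // -[|i] /=; first by split; lia.
  by have [? ? ? ?] := hx i; split=> //; lia.
apply: (run_Seq (T2 := 7) (IH _ _ _ _ m1 _ repe)); [by lia| |by lia].
move=> s2 [m2 v2 f2].
have [f21 f22] : reg s2 1 = n /\ reg s2 2 = 1.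
  by rewrite !f2; try lia; case: rep1'.
do 3 (apply: run_Seq1; apply: run_Add); apply: run_Monus.
set s3 := set_reg _ _ _.
have fr x : x < r -> reg s3 x = reg s1 x.
  by move=> xr; rewrite /= !upd_neq ?f2 //; lia.
have s3r : [/\ reg s3 r = reg s2 r + reg s2 r.+4, reg s3 r.+1 = reg s2 r.+1 + reg s2 2,
    reg s3 r.+2 = reg s2 r.+2 + reg s2 1 & reg s3 r.+3 = reg s2 r.+3 - reg s2 2].
  by split; rewrite /= /update; repeat (case: eqP => ?); lia.
case: s3r => e0 e1 e2 e3.
split=> //; first exact: represents_frame rep1'.
  by move=> x xr; rewrite fr // f1.
rewrite e0 e1 e2 e3 f21 f22 v2 !f2; try lia.
rewrite acc vj rj cj big_ord_recr /= mulSn.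
by split=> //; lia.
Qed.

(** Register 0 holds the length [n * n] of the input.  Subtracting the odd
    numbers 1, 3, 5, ... until it is 0 takes [n] rounds, counted in register 1. *)
Definition compute_order : cmd :=
  Seq (Const 2 1) (Seq (Const 5 1)
    (While 0 (Seq (Monus 0 0 5) (Seq (Add 5 5 2) (Seq (Add 5 5 2) (Add 1 1 2)))))).

Lemma compute_orderP w n : size w = n * n ->
  run compute_order (n * 8 + 5) (init w) (fun s =>
    memory s = memory (init w) /\ represents n s [::] [::] 5).
Proof.
move=> sw.
pose I j (s : state) := [/\ memory s = memory (init w), reg s 1 = j,
  [/\ reg s 2 = 1, reg s 3 = 0 & reg s 4 = 0], reg s 5 = j + j + 1 &
  reg s 0 = n * n - j * j].
rewrite (_ : n * 8 + 5 = (n * 8).+1.+2.+2); last lia.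
do 2 (apply: run_Seq1; apply: run_Const).
apply: (@run_weaken _ _ _ _ (I n)); first exact: leqnn.
  move=> s [m1 r1 [r2 r3 r4] _ _]; split=> //; split=> // i.
  by rewrite !nth_nil.
apply: run_While => [j s jn|s [_ _ _ _ ->]|]; last 2 first.
- by rewrite subnn.
- by split; rewrite //= /update /= ?sw ?subn0.
move=> [m1 r1 [r2 r3 r4] r5 r0]; split; first by rewrite r0; nia.
apply: run_Seq1; apply: run_Monus; do 2 (apply: run_Seq1; apply: run_Add).
apply: run_Add.
by split; rewrite /= /update /= ?r0 ?r1 ?r2 ?r3 ?r4 ?r5 //; nia.
Qed.

Definition matrix_cell (G : sgraph) : nat -> nat := fun i => nth false (encode G) i.

Lemma size_encode (G : sgraph) : size (encode G) = #|G| * #|G|.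
Proof. by rewrite size_allpairs -!cardE. Qed.

(** Properties of graphs definable by a counting formula are decidable in
    polynomial time: the degree of the polynomial depends on the formula only,
    and the number [n] of vertices is bounded by the length of the input. *)
Lemma definable_polytime (C L : sgraph -> Prop) (phi : expr) :
  (forall G, C G -> eval #|G| (matrix_cell G) phi [::] != 0 <-> L G) ->
  polytime_solvable_on C L.
Proof.
move=> def; have [a [k poly]] := cost_poly phi.
exists (Seq compute_order (Seq (compile phi [::] 5) (Add 0 5 3))), (a + 17), k.+1.
move=> G CG; set n := #|G|.
have : run (Seq compute_order (Seq (compile phi [::] 5) (Add 0 5 3)))
    (n * 8 + cost phi n + 8) (init (encode G)) (fun s => accepting s <-> L G).
  apply: (run_Seq (T2 := cost phi n + 2) (compute_orderP (size_encode G)));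
    last by lia.
  move=> s1 [m1 rep1].
  have phiP := compile_correct phi m1 (isT : 2 < 5) rep1.
  apply: (run_Seq (T2 := 1) phiP); last by rewrite addn1 addn2.
  move=> s2 [_ v2 f2]; apply: run_Add; rewrite -(def G CG) /accepting /= /update /=.
  by rewrite v2 f2 // (represents_zero rep1) addn0.
case/halts_in_run => t [s [h le q]]; exists t, s; split=> //.
apply: leq_trans le _; rewrite size_encode -/n.
have Nn : n.+1 <= (n * n).+1 by nia.
have p1 : cost phi n <= a * (n * n).+1 ^ k.
  apply: leq_trans (poly n) _; rewrite leq_mul2l; apply/orP; right.
  by case: (k) => // k'; rewrite leq_exp2r.
have k0 : 0 < (n * n).+1 ^ k by rewrite expn_gt0.
rewrite expnS; move: ((n * n).+1 ^ k) p1 k0 => X p1 k0.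
have : n.+1 <= (n * n).+1 * X by apply: leq_trans Nn _; rewrite leq_pmulr.
have : a * X <= a * ((n * n).+1 * X) by rewrite leq_mul2l leq_pmull ?orbT.
by rewrite mulnDl; lia.
Qed.

(** * Formulas over a graph *)

Lemma nth_allpairs (S T R : Type) (f : S -> T -> R) x0 y0 z0 s t i j :
  i < size s -> j < size t ->
  nth z0 [seq f x y | x <- s, y <- t] (i * size t + j) = f (nth x0 s i) (nth y0 t j).
Proof.
elim: s i => // x s IHs [|i] /= is_ jt; rewrite nth_cat size_map.
  by rewrite add0n jt (nth_map y0).
by rewrite mulSn -addnA ltnNge leq_addr /= addKn IHs.
Qed.

Section Semantics.
Variable G : sgraph.

Definition value (e : expr) (env : seq G) : nat :=
  eval #|G| (matrix_cell G) e [seq val (enum_rank x) | x <- env].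
Definition holds e env := value e env != 0.

Lemma matrix_cellE (x y : G) : matrix_cell G (enum_rank x * #|G| + enum_rank y) = adj x y.
Proof.
have sG : size (enum G) = #|G| by rewrite -cardE.
have rlt (z : G) : enum_rank z < size (enum G) by rewrite sG; apply: ltn_ord.
have := nth_allpairs (fun u v => adj u v : bool) x x false (rlt x) (rlt y).
by rewrite sG !nth_enum_rank /matrix_cell => ->.
Qed.

Lemma nth_ranks (x0 : G) env i : i < size env ->
  nth 0 [seq val (enum_rank x) | x <- env] i = enum_rank (nth x0 env i).
Proof. by move=> ienv; rewrite (nth_map x0). Qed.

Lemma value_Sum e env : value (Sum e) env = \sum_(x : G) value e (x :: env).
Proof.
rewrite /value /= (reindex (@enum_rank G)) //=.
exact: onW_bij (enum_rank_bij _).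
Qed.

Lemma holds_Sum e env : holds (Sum e) env = [exists x : G, holds e (x :: env)].
Proof.
by rewrite /holds value_Sum sum_nat_eq0 negb_forall.
Qed.

Definition And a b := Ite a b (Cst 0).
Definition Or a b := Ite a (Cst 1) b.
Definition Not a := Ite a (Cst 0) (Cst 1).
Definition Eq i j := Not (Or (Sub (Var i) (Var j)) (Sub (Var j) (Var i))).
Definition Xor a b := Ite a (Not b) b.
Definition Exceeds a b := Sub a (Cst b).
Definition Count a := Sum (Ite a (Cst 1) (Cst 0)).
Definition Any (f : nat -> expr) (ks : seq nat) := foldr (fun k => Or (f k)) (Cst 0) ks.

Lemma holds_Ite a b c env :
  holds (Ite a b c) env = if holds a env then holds b env else holds c env.
Proof. by rewrite /holds /value /=; case: ifP. Qed.
Lemma holds_And a b env : holds (And a b) env = holds a env && holds b env.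
Proof. by rewrite /holds /value /=; case: ifP. Qed.
Lemma holds_Or a b env : holds (Or a b) env = holds a env || holds b env.
Proof. by rewrite /holds /value /=; case: ifP. Qed.
Lemma holds_Not a env : holds (Not a) env = ~~ holds a env.
Proof. by rewrite /holds /value /=; case: ifP. Qed.
Lemma holds_Xor a b env : holds (Xor a b) env = (holds a env != holds b env).
Proof. by rewrite holds_Ite holds_Not; do 2 case: (holds _ env). Qed.
Lemma holds_Any f ks env : holds (Any f ks) env = has (fun k => holds (f k) env) ks.
Proof. by elim: ks => //= k ks IH; rewrite holds_Or IH. Qed.
Lemma holds_Adj x0 i j env : i < size env -> j < size env ->
  holds (Adj i j) env = adj (nth x0 env i) (nth x0 env j).
Proof.
by move=> ie je; rewrite /holds /value /= !(nth_ranks x0) // matrix_cellE eqb0 negbK.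
Qed.
Lemma holds_Eq x0 i j env : i < size env -> j < size env ->
  holds (Eq i j) env = (nth x0 env i == nth x0 env j).
Proof.
move=> ie je; rewrite holds_Not holds_Or /holds /value /= !(nth_ranks x0) //.
rewrite negb_or !negbK !subn_eq0 -eqn_leq.
by rewrite -(inj_eq (@enum_rank_inj G)) -(inj_eq val_inj).
Qed.
Lemma holds_Exceeds_Count a d env :
  holds (Exceeds (Count a) d) env = (d < #|[set x | holds a (x :: env)]|).
Proof.
rewrite /holds -[value _ _]/(value (Count a) env - d) value_Sum subn_eq0 -ltnNge.
by rewrite -sum1dep_card [in RHS]big_mkcond.
Qed.

Lemma holds_iter_Sum k e env :
  holds (iter k Sum e) env <->
  exists2 vs : seq G, size vs = k & holds e (vs ++ env).
Proof.
elim: k env => [|k IHk] env /=.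
  split=> [h|[[|//] _ //]]; by exists [::].
rewrite holds_Sum; split=> [/existsP[x /IHk[vs <- h]]|[vs]].
  by exists (rcons vs x); rewrite ?size_rcons // cat_rcons.
case/lastP: vs => // vs x; rewrite size_rcons cat_rcons => -[vsk] h.
by apply/existsP; exists x; apply/(IHk (x :: env)); exists vs.
Qed.

Lemma has_nth_block (x0 : G) (Q : pred G) (s1 s2 s3 : seq G) :
  has (fun k => Q (nth x0 (s1 ++ s2 ++ s3) k)) (iota (size s1) (size s2)) = has Q s2.
Proof.
rewrite -(has_map (nth x0 (s1 ++ s2 ++ s3)) Q) map_nth_iota; last first.
  by rewrite !size_cat addKn leq_addr.
by rewrite drop_size_cat // take_size_cat.
Qed.

End Semantics.

(** * The formula for d-cuts *)

(** Below [s] bound variables, the lists [P], [E] and [F] of [seeds] are the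
    variables [s + i], [s + L + i] and [s + L + L + i] for [i < L]. *)
Definition Seeded L s x :=
  Or (Any (fun k => Eq k x) (iota (s + L + L) L))
     (And (Not (Any (fun k => Eq k x) (iota (s + L) L)))
          (Any (fun k => Adj k x) (iota s L))).

Definition Grown L d s x :=
  Or (Seeded L s x)
     (Exceeds (Count (And (Adj x.+1 0) (Seeded L s.+1 0))) d).

Definition Cut L d :=
  And (Sum (Grown L d 1 0)) (And (Sum (Not (Grown L d 1 0)))
    (Not (Sum (Exceeds
       (Count (And (Adj 1 0) (Xor (Grown L d 2 1) (Grown L d 2 0)))) d)))).

Section Formula.
Variables (G : sgraph) (d L : nat) (P E F : seq G).
Hypotheses (sP : size P = L) (sE : size E = L) (sF : size F = L).
Let A := grow d (seeds P E F).

Lemma holds_Seeded x0 inner x : x < size inner ->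
  holds (Seeded L (size inner) x) (inner ++ P ++ E ++ F)
  = (nth x0 inner x \in seeds P E F).
Proof.
move=> xi; set env := inner ++ _.
have envx : nth x0 env x = nth x0 inner x by rewrite nth_cat xi.
have senv : size env = size inner + (L + L + L).
  by rewrite !size_cat sP sE sF !addnA.
have xe : x < size env by rewrite senv; lia.
(* a disjunction over a block of variables quantifies over the listed vertices *)
have Any_in (f : nat -> expr) (Q : pred G) (s1 s2 s3 : seq G) : size s2 = L ->
    env = s1 ++ s2 ++ s3 ->
    (forall k, k < size env -> holds (f k) env = Q (nth x0 env k)) ->
    holds (Any f (iota (size s1) L)) env = has Q s2.
  move=> s2L eqenv fQ; rewrite holds_Any -(has_nth_block x0 Q s1 s2 s3) -eqenv s2L.
  apply: eq_in_has => k; rewrite mem_iota => /andP[_ k2]; apply: fQ.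
  by apply: leq_trans k2 _; rewrite eqenv !size_cat s2L; lia.
have memE (s : seq G) y : has (pred1 y) s = (y \in s) by rewrite has_pred1.
rewrite inE -envx holds_Or holds_And holds_Not; congr (_ || ~~ _ && _).
- rewrite -memE.
  have -> : size inner + L + L = size (inner ++ P ++ E).
    by rewrite !size_cat sP sE addnA.
  apply: (Any_in _ _ _ _ [::]) => // [|k ke]; first by rewrite cats0 /env -!catA.
  by rewrite (holds_Eq x0).
- rewrite -memE.
  have -> : size inner + L = size (inner ++ P) by rewrite size_cat sP.
  apply: (Any_in _ _ _ _ F) => // [|k ke]; first by rewrite /env -!catA.
  by rewrite (holds_Eq x0).
apply: (Any_in _ _ _ _ (E ++ F)) => // k ke.
by rewrite (holds_Adj x0).
Qed.

Lemma holds_Grown x0 inner x : x < size inner ->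
  holds (Grown L d (size inner) x) (inner ++ P ++ E ++ F) = (nth x0 inner x \in A).
Proof.
move=> xi; rewrite holds_Or (holds_Seeded x0) // holds_Exceeds_Count /A [in RHS]inE.
congr (_ || (d < _)); apply: eq_card => y; rewrite [LHS]inE [in RHS]inE holds_And.
rewrite -cat_cons (holds_Adj x0) ?size_cat /= ?size_cat; try lia.
by rewrite nth_cat xi [in RHS]inE -(holds_Seeded x0 (inner := y :: inner) (x := 0)).
Qed.

Lemma holds_Cut : holds (Cut L d) (P ++ E ++ F) <-> is_d_cut d A (~: A).
Proof.
(* A is made opaque: unfolding membership must stop at it *)
move: (A) holds_Grown => S GA.
have degA (v : G) :
    [set w | holds (And (Adj 1 0) (Xor (Grown L d 2 1) (Grown L d 2 0)))
              (w :: v :: P ++ E ++ F)] = [set w | adj v w & (v \in S) != (w \in S)].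
  apply/setP=> w; rewrite !inE holds_And holds_Xor (holds_Adj v) //=.
  by rewrite (GA v [:: w; v] 1) // (GA v [:: w; v] 0).
rewrite /Cut !holds_And holds_Not !holds_Sum negb_exists; split.
  case/and3P=> /existsP[a aA] /existsP[b bA] /forallP deg.
  have {}deg v : #|[set w | adj v w & (v \in S) != (w \in S)]| <= d.
    by have := deg v; rewrite holds_Exceeds_Count degA -leqNgt.
  split.
  - split; apply/set0Pn; [exists a|exists b]; first by rewrite -(GA a [:: a] 0).
    by move: bA; rewrite holds_Not (GA b [:: b] 0) // inE.
  - by rewrite setUCr setICr.
  - move=> u uA; apply: leq_trans (deg u); apply: subset_leq_card.
    by apply/subsetP=> w; rewrite !inE uA => /andP[/negPf -> ->].
  - move=> u uA; apply: leq_trans (deg u); apply: subset_leq_card.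
    by apply/subsetP=> w; rewrite !inE; move: uA; rewrite inE => /negPf -> /andP[-> ->].
case=> -[/set0Pn[a aA] /set0Pn[b bA]] _ cutA cutB; apply/and3P; split.
- by apply/existsP; exists a; rewrite (GA a [:: a] 0).
- by apply/existsP; exists b; rewrite holds_Not (GA b [:: b] 0) //=; rewrite inE in bA.
apply/forallP=> v; rewrite holds_Exceeds_Count degA -leqNgt.
case: (boolP (v \in S)) => vA.
  apply: leq_trans (cutA v vA); apply: subset_leq_card.
  by apply/subsetP=> w; rewrite !inE => /andP[-> ]; case: (w \in S).
apply: leq_trans (cutB v _); last by rewrite inE.
by apply: subset_leq_card; apply/subsetP=> w; rewrite !inE => /andP[-> ]; case: (w \in S).
Qed.

End Formula.

Unset Implicit Arguments.

Theorem theorem11 (d : nat) (hd : 1 <= d) :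
  polytime_solvable_on
    (fun G : sgraph => bipartite G /\ diameter_le G 3) (has_d_cut d).
Proof.
pose L := num_seeds d.
apply: (@definable_polytime _ _ (iter (L + (L + L)) Sum (Cut L d))) => G [bip diam].
rewrite -[_ != 0]/(holds (iter (L + (L + L)) Sum (Cut L d)) (Nil G)).
split=> [/holds_iter_Sum[vs svs]|[A [B cut]]].
  rewrite cats0 => h.
  have sP : size (take L vs) = L by rewrite size_take svs; case: ifP; lia.
  have sE : size (take L (drop L vs)) = L.
    by rewrite size_take size_drop svs; case: ifP; lia.
  have sF : size (drop L (drop L vs)) = L by rewrite !size_drop svs; lia.
  rewrite -(cat_take_drop L vs) -(cat_take_drop L (drop L vs)) in h.
  by have := (holds_Cut d sP sE sF).1 h; do 2 eexists; eassumption.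
have [P [E [F [sP sE sF eA]]]] := d_cut_grown bip diam cut.
apply/holds_iter_Sum; exists (P ++ E ++ F); first by rewrite !size_cat sP sE sF.
rewrite cats0; apply/(holds_Cut d sP sE sF); rewrite -eA.
suff -> : ~: A = B by [].
case: cut => _ [AB AB0] _ _; apply/setP=> v; rewrite inE.
move/setP/(_ v): AB; move/setP/(_ v): AB0; rewrite !inE.
by case: (v \in A); case: (v \in B).
Qed.
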